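(* Let $G$ be a graph with $v$ vertices, and let $H^{*}_{\mathcal A_2}(G)=\bigoplus_{i,j}H^{i,j}_{\mathcal A_2}(G)$ be its graph cohomology over $\mathcal A_2=\mathbb Z[x]/(x^2)$. Then $H^{*}_{\mathcal A_2}(G)$ contains nontrivial torsion if and only if $G$ has no loops and contains a cycle of length at least $3$. In this case, if $G$ contains a cycle of odd length $\ge 3$ then $H^{1,v-1}_{\mathcal A_2}(G)$ contains $\mathbb Z_2$-torsion (an element of order $2$), and if $G$ contains a cycle of even length $\ge 4$ then $H^{2,v-2}_{\mathcal A_2}(G)$ contains $\mathbb Z_2$-torsion.
   Context: Graphs are finite and undirected, and may have loops and multiple edges. $\mathcal A=\mathcal A_2=\mathbb Z[x]/(x^2)$ is graded with $\deg 1=0$, $\deg x=1$. Graph cohomology over $\mathcal A$: let $G$ be a graph with ordered edges $e_1,\dots,e_n$. For $s\subseteq E(G)$ let $[G:s]$ be the graph with vertex set $V(G)$ and edge set $s$, and let $C^{s}(G)=\mathcal A^{\otimes k}$ (tensor over $\mathbb Z$, one factor per connected component of $[G:s]$, $k$ being the number of components), with the induced grading. Put $C^i(G)=\bigoplus_{|s|=i}C^s(G)$. For $e\notin s$ the per-edge map $C^{s}(G)\to C^{s\cup\{e\}}(G)$ is the identity if $e$ joins a component of $[G:s]$ to itself; if $e$ joins two different components it multiplies the two corresponding tensor factors via $\mathcal A\otimes\mathcal A\to\mathcal A$ and is the identity on the other factors. The differential $d^i:C^i(G)\to C^{i+1}(G)$ is the sum of the per-edge maps over all $|s|=i$ and $e=e_r\notin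 s$, with sign $(-1)^{\#\{t<r:\ e_t\in s\}}$. It preserves degree; $H^{i,j}_{\mathcal A}(G)$ is the degree $j$ part of the $i$-th cohomology $H^i_{\mathcal A}(G)$. *)

(* Defs.v *)
From HB Require Import structures.
From mathcomp Require Import all_boot all_algebra.
From mathcomp Require Import boolp.

Set Implicit Arguments.
Unset Strict Implicit.
Unset Printing Implicit Defensive.
Import GRing.Theory.
Local Open Scope ring_scope.

Section DirectSum.
Variables (I : finType) (M : I -> zmodType).

Definition dsum : Type := {dffun forall i : I, M i}.
HB.instance Definition _ := Choice.on dsum.

Implicit Types f g h : dsum.
Definition dsum0 : dsum := [ffun i : I => 0 : M i].
Definition dsum_opp f : dsum := [ffun i : I => - f i : M i].
Definition dsum_add f g : dsum := [ffun i : I => f i + g i : M i].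

Fact dsum_addA : associative dsum_add.
Proof. by move=> f g h; apply/ffunP=> i; rewrite !ffunE addrA. Qed.
Fact dsum_addC : commutative dsum_add.
Proof. by move=> f g; apply/ffunP=> i; rewrite !ffunE addrC. Qed.
Fact dsum_add0 : left_id dsum0 dsum_add.
Proof. by move=> f; apply/ffunP=> i; rewrite !ffunE add0r. Qed.
Fact dsum_addN : left_inverse dsum0 dsum_opp dsum_add.
Proof. by move=> f; apply/ffunP=> i; rewrite !ffunE addNr. Qed.

HB.instance Definition _ :=
  GRing.isZmodule.Build dsum dsum_addA dsum_addC dsum_add0 dsum_addN.
End DirectSum.

Definition A2 : comNzRingType := {poly %/ ('X^2 : {poly int})}.
Definition A2_x : A2 := 'qX.
Definition A2_coef (m : nat) (a : A2) : int :=
  (a : {poly %/ ('X^2 : {poly int})})`_m.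

Fact A2_coefB (m : nat) : {morph A2_coef m : a b / a - b}.
Proof. by move=> a b; rewrite /A2_coef /= coefB. Qed.

HB.instance Definition _ m :=
  GRing.isZmodMorphism.Build A2 int (A2_coef m) (@A2_coefB m).

Fact A2_coefX (n m : nat) : (n < 2)%N -> A2_coef m (A2_x ^+ n) = (m == n)%:R.
Proof.
move=> n2; have h2 : (2 < size ('X^2 : {poly int}))%N by rewrite size_polyXn.
rewrite /A2_coef /A2_x; case: n n2 => [|[|]] // _.
  by rewrite expr0 /= coef1.
  by rewrite expr1 (qpolyXE h2 (monicXn _ 2)) coefX.
Qed.

Fact A2_basis (a : A2) : a = \sum_(m < 2) A2_x ^+ m *~ A2_coef m a.
Proof.
apply: val_inj; apply/polyP=> n.
rewrite -[LHS]/(A2_coef n a) -[RHS]/(A2_coef n _).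
rewrite raddf_sum /=.
have [n2|n2] := ltnP n 2.
  rewrite (bigD1 (Ordinal n2)) //= big1 => [|m mn].
    by rewrite addr0 raddfMz /= A2_coefX // eqxx intz.
  rewrite raddfMz /= A2_coefX //.
  rewrite (_ : (n == m) = false) ?mul0rz //.
  by apply: contra_neqF mn => /eqP nm; apply: val_inj.
rewrite big1 => [|m _].
  apply: nth_default; apply: leq_trans n2.
  by rewrite (leq_trans (size_npoly a)) // mk_monic_Xn size_polyXn.
rewrite raddfMz /= A2_coefX //.
by rewrite gtn_eqF ?mul0rz // (leq_trans _ n2).
Qed.

(* A2 is Z-free on 1 = x^0 and x = x^1, so its tensor power over Z indexed by
   the finite set K is Z-free on the tensors (x)_k x^(b k), b : K -> {0, 1};
   an element is given by its coordinates in that basis. *)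
Definition tens (K : finType) : Type := {ffun {ffun K -> 'I_2} -> int}.
HB.instance Definition _ K := GRing.Zmodule.on (tens K).

Definition pure (K : finType) (a : K -> A2) : tens K :=
  [ffun b : {ffun K -> 'I_2} => \prod_k A2_coef (b k) (a k)].

(* The linear map sending (x)_k a_k to (x)_l (\prod_(k in phi^-1 l) a_k), given
   on basis tensors; see tens_map_pure. *)
Definition tens_map (K L : finType) (phi : K -> L) (t : tens K) : tens L :=
  \sum_(b : {ffun K -> 'I_2})
    pure (fun l => \prod_(k | phi k == l) A2_x ^+ b k) *~ t b.

Fact tens_mapB (K L : finType) (phi : K -> L) :
  {morph tens_map phi : t u / t - u}.
Proof.
move=> t u; rewrite /tens_map -sumrB; apply: eq_bigr => b _.
by rewrite !ffunE mulrzBr.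
Qed.

Lemma tens_map_pure (K L : finType) (phi : K -> L) (a : K -> A2) :
  tens_map phi (pure a) = pure (fun l => \prod_(k | phi k == l) a k).
Proof.
pose x0 : 'I_2 := ord0.
apply/ffunP=> c; rewrite /tens_map sum_ffunE ffunE.
have step l : A2_coef (c l) (\prod_(k | phi k == l) a k) =
  \sum_(f in pfamily x0 (fun k => phi k == l) (fun=> xpredT))
     A2_coef (c l) (\prod_(k | phi k == l) A2_x ^+ f k) *
     \prod_(k | phi k == l) A2_coef (f k) (a k).
  under eq_bigr => k _ do rewrite [a k]A2_basis.
  rewrite (big_distr_big_dep x0).
  rewrite raddf_sum /=.
  apply: eq_bigr => f _.
  have -> : \prod_(k | phi k == l) (A2_x ^+ f k *~ A2_coef (f k) (a k)) =
    (\prod_(k | phi k == l) A2_x ^+ f k)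
      *~ \prod_(k | phi k == l) A2_coef (f k) (a k).
    apply: (big_rec3 (fun u v w => u = v *~ w)) => [|k u v w _ ->].
      by rewrite mulr1z.
    by rewrite mulrzAr mulrzAl mulrzA.
  by rewrite raddfMz /= mulrzz.
under [RHS]eq_bigr => l _ do rewrite step.
rewrite bigA_distr_big_dep /=.
pose h (b : {ffun K -> 'I_2}) : {ffun L -> {ffun K -> 'I_2}} :=
  [ffun l => [ffun k => if phi k == l then b k else x0]].
pose h' (g : {ffun L -> {ffun K -> 'I_2}}) : {ffun K -> 'I_2} :=
  [ffun k => g (phi k) k].
rewrite [RHS](reindex_onto h h') /=; last first.
  move=> g /familyP gP; apply/ffunP=> l; apply/ffunP=> k; rewrite !ffunE.
  case: eqP => [->//|/eqP kl].
  have /pfamilyP[/supportP -> //] := gP l.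
apply: eq_big => [b|b _].
  apply/esym/andP; split.
    apply/familyP=> l; apply/pfamilyP; split=> [|k _]; last by [].
    by apply/supportP=> k kl; rewrite !ffunE ifN.
  by apply/eqP/ffunP=> k; rewrite !ffunE eqxx.
rewrite ffunMzE !ffunE mulrzz [in RHS]big_split /=; congr (_ * _).
  apply: eq_bigr => l _; congr (A2_coef _ _); apply: eq_bigr => k /eqP kl.
  by rewrite !ffunE kl eqxx.
rewrite (partition_big phi xpredT) //=; apply: eq_bigr => l _.
by apply: eq_bigr => k /eqP kl; rewrite !ffunE kl eqxx.
Qed.

(* The edges are the indices e : 'I_(nedges G), ordered as such; the order of
   the two components of ends e is never used. *)
Record mgraph := MGraph {
  vert : finType;
  nedges : nat;
  ends : 'I_nedges -> vert * vert }.

Section Cohomology.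
Variable G : mgraph.
Notation V := (vert G).
Notation E := 'I_(nedges G).

Definition adj (s : {set E}) : rel V :=
  fun u w => [exists e in s, (ends e == (u, w)) || (ends e == (w, u))].

Fact adj_connect_sym s : connect_sym (adj s).
Proof.
by apply: sym_connect_sym => u w; apply: eq_existsb => e; rewrite orbC.
Qed.

(* The connected components of [G:s], each given by its canonical vertex. *)
Definition comp (s : {set E}) : finType := {u : V | fingraph.roots (adj s) u}.

Definition comp_of (s : {set E}) (u : V) : comp s :=
  exist _ (fingraph.root (adj s) u) (roots_root (@adj_connect_sym s) u).

(* Used for s' = e |: s only. If e joins two components of [G:s], this
   multiplies their tensor factors; otherwise comp_of s' is a bijection between
   the components and this is the identity up to renaming of the factors. *)
Definition edge_map (s s' : {set E}) : tens (comp s) -> tens (comp s') :=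
  tens_map (fun k => comp_of s' (val k)).

Definition subsets (i : nat) : finType := {s : {set E} | #|s| == i}.

Definition cochain (i : nat) : zmodType :=
  dsum (fun s : subsets i => tens (comp (val s)) : zmodType).

Definition diff (i : nat) (t : cochain i) : cochain i.+1 :=
  [ffun s' : subsets i.+1 =>
    \sum_(s : subsets i) \sum_(e | (e \notin val s) && (e |: val s == val s'))
      edge_map (val s') (t s)
        *~ (-1) ^+ #|[set f in val s | (f < e)%N]| : tens (comp (val s'))].

Definition homog (i j : nat) (t : cochain i) : Prop :=
  forall (s : subsets i) (b : {ffun comp (val s) -> 'I_2}),
    t s b != 0 -> (\sum_k b k)%N = j.

Definition cocycle_pred (i : nat) : {pred cochain i} := [pred t | diff t == 0].
Arguments cocycle_pred : clear implicits.

Fact diffB i : {morph @diff i : t u / t - u}.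
Proof.
move=> t u; apply/ffunP=> s'; rewrite !ffunE -sumrB; apply: eq_bigr => s _.
rewrite -sumrB; apply: eq_bigr => e _.
by rewrite !ffunE /edge_map tens_mapB mulrzBl.
Qed.

Fact diff0 i : @diff i 0 = 0.
Proof. by rewrite -[X in diff X](subrr 0) diffB subrr. Qed.

Fact cocycle_closed i : zmod_closed (cocycle_pred i).
Proof.
split=> [|t u]; rewrite !inE ?diff0 // diffB => /eqP-> /eqP->.
by rewrite subr0.
Qed.
HB.instance Definition _ i :=
  GRing.isZmodClosed.Build (cochain i) (cocycle_pred i) (@cocycle_closed i).

Definition cocycle (i : nat) : Type := {t : cochain i | cocycle_pred i t}.
HB.instance Definition _ i := SubChoice.on (cocycle i).
HB.instance Definition _ i := [SubChoice_isSubZmodule of cocycle i by <:].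

Definition is_coboundary (i : nat) : cochain i -> Prop :=
  match i with
  | 0 => fun t => t = 0
  | i'.+1 => fun t => exists y : cochain i', diff y = t
  end.

Definition coboundary_pred (i : nat) : {pred cocycle i} :=
  [pred z | `[< is_coboundary (val z) >]].
Arguments coboundary_pred : clear implicits.

Fact coboundary_closed i : zmod_closed (coboundary_pred i).
Proof.
split=> [|z w]; rewrite !inE.
  by apply/asboolP; case: i => [|i] //=; exists 0; rewrite diff0.
move=> /asboolP hz /asboolP hw; apply/asboolP; move: z w hz hw.
case: i => [|i] z w /=; first by move=> -> ->; rewrite subr0.
by move=> [y <-] [y' <-]; exists (y - y'); rewrite diffB.
Qed.
HB.instance Definition _ i :=
  GRing.isZmodClosed.Build (cocycle i) (coboundary_pred i)
    (@coboundary_closed i).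

Definition coh (i : nat) : zmodType :=
  Quotient.quot (coboundary_pred i : zmodClosed (cocycle i)).

Definition coh_class (i : nat) (z : cocycle i) : coh i := (\pi z)%qT.

Definition coh_deg_pred (i j : nat) : {pred coh i} :=
  [pred h | `[< exists2 z : cocycle i, homog j (val z) & coh_class z = h >]].
Arguments coh_deg_pred : clear implicits.

Fact homogB i j (t u : cochain i) : homog j t -> homog j u -> homog j (t - u).
Proof.
move=> ht hu s b; rewrite !ffunE => hb.
have [t0|] := eqVneq (t s b) 0; last exact: ht.
have [u0|] := eqVneq (u s b) 0; last exact: hu.
by rewrite t0 u0 subr0 eqxx in hb.
Qed.

Fact coh_deg_closed i j : zmod_closed (coh_deg_pred i j).
Proof.
split=> [|h k]; rewrite !inE.
  apply/asboolP; exists 0; last by rewrite /coh_class raddf0.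
  by move=> s b; rewrite !ffunE eqxx.
move=> /asboolP[z hz <-] /asboolP[w hw <-]; apply/asboolP; exists (z - w).
  exact: homogB.
by rewrite /coh_class raddfB.
Qed.
HB.instance Definition _ i j :=
  GRing.isZmodClosed.Build (coh i) (coh_deg_pred i j) (@coh_deg_closed i j).

Definition coh_deg (i j : nat) : Type := {h : coh i | coh_deg_pred i j h}.
HB.instance Definition _ i j := SubChoice.on (coh_deg i j).
HB.instance Definition _ i j := [SubChoice_isSubZmodule of coh_deg i j by <:].

(* coh_deg i j is trivial unless i <= #|E| and j <= #|V|, so the sum over all
   i, j is this finite one. *)
Definition coh_total : zmodType :=
  dsum (fun ij : 'I_(nedges G).+1 * 'I_#|V|.+1 =>
          coh_deg ij.1 ij.2 : zmodType).

Definition loopless : Prop := forall e : E, (ends e).1 != (ends e).2.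

(* For k >= 3 only: consecutive vertices of p are adjacent (cyclically) and p
   has no repetition; then the edges used are automatically distinct. *)
Definition has_cycle (k : nat) : Prop :=
  exists2 p : seq V, ucycle (adj [set: E]) p & size p = k.

End Cohomology.

Definition has_torsion (M : zmodType) : Prop :=
  exists h : M, h <> 0 /\ exists2 m : nat, (0 < m)%N & h *+ m = 0.

Definition has_2torsion (M : zmodType) : Prop :=
  exists h : M, h <> 0 /\ h *+ 2 = 0.

(* Main.v *)
(* Let e be a loop, or an edge from u to a vertex w all of whose edges are
   parallel to e. Removing e from an edge set while multiplying the factor of w
   into that of u is a contracting homotopy: for a loop on all cochains, and
   otherwise on those vanishing on the edge sets that avoid e. By induction on
   the edges, a graph with a loop or without cycles of length at least 3 has no
   cohomology in positive degree; and H^0 is always a subgroup of a free group.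

   Conversely, if d y is even then z = d y / 2 is a cocycle with 2 z = d y, and
   z is not a coboundary as soon as some additive h is even on coboundaries with
   h (d y) not divisible by 4. Let C be a cycle of length k, and let y be
   supported on a set of edge sets s, with value on s the sum of the basis
   tensors having one factor 1 and all the others x. For k odd, take s empty and
   let h add up the coefficients of x (x) ... (x) x over the edges of C, so that
   h (d y) = 2 k. For k even, take for s a fixed edge of C and its parallels,
   and let h add up the coefficients of x (x) ... (x) x over the pairs of edges
   of C, so that h (d y) = 2 (k - 1) modulo 4. *)

From HB Require Import structures.
From mathcomp Require Import all_boot all_algebra.
From mathcomp Require Import boolp ring zify.
Require Import Defs.

Set Implicit Arguments.
Unset Strict Implicit.
Unset Printing Implicit Defensive.
Import GRing.Theory Num.Theory.

Local Open Scope ring_scope.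

(** * Tensor powers *)

Lemma A2_x_sqr : A2_x ^+ 2 = 0.
Proof.
rewrite expr2 /A2_x -[in LHS]in_qpolyM -expr2; apply: val_inj.
have /eqP: Pdiv.Ring.rmodp 'X^2 (mk_monic 'X^2) == 0 :> {poly int}.
  by rewrite mk_monic_Xn Pdiv.RingMonic.rmodpp ?monicXn.
by [].
Qed.

Lemma A2_coef_exp (n : nat) (m : 'I_2) :
  A2_coef m (A2_x ^+ n) = (m == n :> nat)%:R.
Proof.
have [n2|n2] := ltnP n 2; first exact: A2_coefX.
rewrite -(subnK n2) exprD A2_x_sqr mulr0 raddf0 subnK //.
by case: eqP => // mn; have := ltn_ord m; rewrite mn ltnNge n2.
Qed.

HB.instance Definition _ (K L : finType) (phi : K -> L) :=
  GRing.isZmodMorphism.Build (tens K) (tens L) (tens_map phi)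
    (@tens_mapB K L phi).

Section TensorMaps.
Variables K L M : finType.
Implicit Types (phi : K -> L) (psi : L -> M).

Lemma eq_tens_map phi phi' : phi =1 phi' -> tens_map phi =1 tens_map phi'.
Proof.
move=> eq_phi t; apply: eq_bigr => b _; congr (pure _ *~ _).
by apply/funext => l; apply: eq_bigl => k; rewrite eq_phi.
Qed.

(** Labels are exponents of [x], added as natural numbers: a fibre with sum at least 2 matches no
    label, in accordance with [x^2 = 0]. *)
Definition pushes phi (b : {ffun K -> 'I_2}) (c : {ffun L -> 'I_2}) :=
  [forall l, (\sum_(k | phi k == l) b k)%N == c l].

Lemma tens_mapE phi (t : tens K) c :
  tens_map phi t c = \sum_(b | pushes phi b c) t b.
Proof.
rewrite sum_ffunE [RHS]big_mkcond; apply: eq_bigr => b _.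
rewrite ffunMzE ffunE mulrzz.
under eq_bigr => l _ do rewrite prodrXr A2_coef_exp.
case: ifPn => [/forallP h|/forallPn[l hl]].
  by rewrite big1 ?mul1r // => l _; rewrite eq_sym h.
by rewrite (bigD1 l) //= eq_sym (negPf hl) !mul0r.
Qed.

(** By linearity basis tensors suffice; there [tens_map_pure] reduces the claim to regrouping a
    product along the fibres of [phi]. *)
Lemma tens_map_comp phi psi (t : tens K) :
  tens_map psi (tens_map phi t) = tens_map (psi \o phi) t.
Proof.
rewrite [tens_map phi t]/tens_map (raddf_sum (tens_map psi));
  apply: eq_bigr => b _.
rewrite (raddfMz (tens_map psi)) [X in X *~ _]tens_map_pure;
  congr (pure _ *~ _).
apply/funext => m; rewrite [RHS](partition_big phi (fun l => psi l == m)) //=.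
apply: eq_bigr => l /eqP lm; apply: eq_bigl => k.
by case: eqP => [->|]; rewrite ?andbF // lm eqxx.
Qed.

Lemma pushes_degree phi b c :
  pushes phi b c -> (\sum_k b k = \sum_l c l)%N.
Proof.
move=> /forallP h; rewrite (partition_big phi xpredT) //=.
by apply: eq_bigr => l _; apply/eqP.
Qed.

End TensorMaps.

Lemma tens_map_id (K : finType) (t : tens K) : tens_map id t = t.
Proof.
apply/ffunP => c; rewrite tens_mapE (big_pred1 c) // => b /=.
apply/forallP/eqP => [h|-> l]; last by rewrite big_pred1_eq.
by apply/ffunP => l; apply: val_inj; move: (h l); rewrite big_pred1_eq => /eqP.
Qed.

(** * Cochain families *)

Section Graph.
Variable G : mgraph.
Notation V := (vert G).
Notation E := 'I_(nedges G).
Implicit Types (s r : {set E}) (e f : E) (rho : V -> V).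

Lemma comp_of_eq s u w : (comp_of s u == comp_of s w) = connect (adj s) u w.
Proof. by rewrite -val_eqE /= root_connect //; apply: adj_connect_sym. Qed.

Lemma comp_of_val s (k : comp s) : comp_of s (val k) = k.
Proof. by apply: val_inj; case: k => u /= /eqP. Qed.

Lemma connect_adj_sub s r u w :
  s \subset r -> connect (adj s) u w -> connect (adj r) u w.
Proof.
move=> /subsetP sr; apply: connect_sub => a b /exists_inP[e es h].
by apply/connect1/exists_inP; exists e => //; apply: sr.
Qed.

(** For [rho = id] this is the per-edge map; a [rho] that moves a vertex occurs in the contracting
    homotopies. *)
Definition push rho s r (t : tens (comp s)) : tens (comp r) :=
  tens_map (fun k => comp_of r (rho (val k))) t.

Lemma pushB rho s r : {morph @push rho s r : t t' / t - t'}.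
Proof. exact: tens_mapB. Qed.

(** The inner map replaces [rho (val k)] by the canonical vertex of its component in [[G:r]], and
    [rho'] must send both into the same component of [[G:q]]. *)
Lemma push_comp rho rho' s r q (t : tens (comp s)) :
  (forall u w, connect (adj r) u w -> connect (adj q) (rho' u) (rho' w)) ->
  push rho' q (push rho r t) = push (rho' \o rho) q t.
Proof.
move=> h; rewrite /push tens_map_comp; apply: eq_tens_map => k /=.
apply/eqP; rewrite comp_of_eq; apply: h.
by rewrite adj_connect_sym connect_root.
Qed.

Lemma push_id rho s (t : tens (comp s)) :
  (forall u, connect (adj s) (rho u) u) -> push rho s t = t.
Proof.
move=> h; rewrite -[RHS]tens_map_id; apply: eq_tens_map => k.
by apply/eqP; rewrite -[X in _ == X]comp_of_val comp_of_eq.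
Qed.

Definition before s e : nat := #|[set f in s | (f < e)%N]|.

Lemma before_setD1 s e f :
  e \in s -> before s f = (before (s :\ e) f + (e < f)%N)%N.
Proof.
move=> es; rewrite /before (cardsD1 e) inE es /= addnC; congr (_ + _)%N.
by apply: eq_card => g; rewrite !inE andbA.
Qed.

Lemma before_setU1 s e f :
  e \notin s -> before (e |: s) f = (before s f + (e < f)%N)%N.
Proof. by move=> es; rewrite (@before_setD1 _ e) ?setU11 // setU1K. Qed.

Lemma sign_addnn n : (-1) ^+ (n + n) = 1 :> int.
Proof. by rewrite addnn -muln2 exprM sqrr_sign. Qed.

End Graph.

(* Only these properties of the tensor powers and of push matter for the
   homotopy argument. *)
Record coefficients (G : mgraph) := Coefficients {
  coef_grp :> {set 'I_(nedges G)} -> zmodType;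
  tr : forall (rho : vert G -> vert G) s r, coef_grp s -> coef_grp r;
  trB : forall rho s r, {morph @tr rho s r : t t' / t - t'};
  tr_comp : forall rho rho' s r q (t : coef_grp s),
    (forall u w, connect (adj r) u w -> connect (adj q) (rho' u) (rho' w)) ->
    @tr rho' r q (@tr rho s r t) = @tr (rho' \o rho) s q t;
  tr_id : forall rho s (t : coef_grp s),
    (forall u, connect (adj s) (rho u) u) -> @tr rho s s t = t;
  coef_mulr2n_eq0 : forall s (t : coef_grp s), t *+ 2 = 0 -> t = 0 }.
Arguments tr {G A} rho {s} r t : rename.

(** * The complex of families and its differential *)

Section Complex.
Variables (G : mgraph) (A : coefficients G).
Notation V := (vert G).
Notation E := 'I_(nedges G).
Implicit Types (s r : {set E}) (e f : E) (rho : V -> V).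

HB.instance Definition _ rho s r :=
  GRing.isZmodMorphism.Build (A s) (A r) (@tr G A rho s r) (@trB G A rho s r).

(** Indexing by all edge sets treats all cohomological degrees at once and attaches no proof of
    cardinality to a set. *)
Definition family := forall s, A s.
Implicit Types T Y : family.

(** [T s] and [T s'] have different types; they become comparable once sent to [A r]. *)
Lemma tr_set_eq T rho s s' r : s = s' -> tr rho r (T s) = tr rho r (T s').
Proof. by move=> ->. Qed.

(** The differential indexed by its target. The sign may be computed in [s] rather than [s :\ e]
    because [before] does not count [e] itself. *)
Definition bdry T : family := fun s =>
  \sum_(e in s) tr id s (T (s :\ e)) *~ (-1) ^+ before s e.

Lemma bdryB T Y s : bdry (fun r => T r - Y r) s = bdry T s - bdry Y s.
Proof.
by rewrite /bdry -sumrB; apply: eq_bigr => e _; rewrite raddfB mulrzBl.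
Qed.

Lemma eq_bdry T Y s :
  (forall e, e \in s -> T (s :\ e) = Y (s :\ e)) -> bdry T s = bdry Y s.
Proof. by move=> h; apply: eq_bigr => e es; rewrite h. Qed.

(** Removing two edges in either order gives the same map with opposite signs. *)
Lemma bdry_bdry T s : bdry (bdry T) s = 0.
Proof.
pose X e f := tr id s (T (s :\ e :\ f))
  *~ ((-1) ^+ before (s :\ e) f * (-1) ^+ before s e).
have XE : bdry (bdry T) s = \sum_(e in s) \sum_(f in s :\ e) X e f.
  apply: eq_bigr => e _; rewrite raddf_sum mulrz_suml.
  apply: eq_bigr => f _; rewrite raddfMz -mulrzA; congr (_ *~ _).
  by apply: tr_comp => u w; apply: connect_adj_sub; apply: subsetDl.
(* Adding the double sum to its transpose cancels the term at (e, f) against the one at (f, e), with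
   no need to single out the pairs with e < f. *)
apply: coef_mulr2n_eq0.
rewrite mulr2n {1}XE (exchange_big_dep (mem s)) /=; last first.
  by move=> e f es; rewrite !inE => /andP[].
rewrite XE -big_split big1 //= => e es.
rewrite (eq_bigl (mem (s :\ e))); last first.
  by move=> f; rewrite !inE es andbT eq_sym andbC.
rewrite -big_split big1 //= => f; rewrite !inE => /andP[fe fs].
rewrite /X (tr_set_eq T id s (_ : s :\ f :\ e = s :\ e :\ f)); last first.
  by apply/setP => g; rewrite !inE andbCA.
rewrite -mulrzDr (_ : _ + _ = 0) ?mulr0z //; apply/eqP; rewrite addr_eq0.
rewrite (before_setD1 f es) (before_setD1 e fs).
by case: ltngtP fe => [_|_|/val_inj->];
  rewrite ?eqxx // ?addn0 ?addn1 ?exprS ?mulN1r ?mulNr ?mulrN ?opprK mulrC.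
Qed.

End Complex.

(** * Contracting homotopies *)

Lemma connect_homo (T T' : finType) (e : rel T) (e' : rel T') (h : T -> T') :
  (forall x y, e x y -> connect e' (h x) (h y)) ->
  forall x y, connect e x y -> connect e' (h x) (h y).
Proof.
move=> he x y /connectP[p]; elim: p x => [|z p IHp] x /=; first by move=> _ ->.
by case/andP=> /he xz zp /(IHp _ zp); apply: connect_trans.
Qed.

Section Homotopy.
Variables (G : mgraph) (A : coefficients G).
Notation V := (vert G).
Notation E := 'I_(nedges G).
Implicit Types (s r : {set E}) (T : family A).
Variables (F : {set E}) (e : E) (rho : V -> V).
Hypothesis eF : e \in F.
Hypothesis rho_adj : forall s u w, s \subset F ->
  connect (adj (e |: s)) u w -> connect (adj s) (rho u) (rho w).
Hypothesis rho_connect : forall u, connect (adj [set e]) (rho u) u.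

(** By [rho_adj], [rho] respects connectivity from [e |: s] to [s]; by [rho_connect] it moves
    vertices only along [e]. *)
Definition homotopy T : family A := fun s =>
  if e \in s then 0
  else tr rho s (T (e |: s)) *~ (-1) ^+ before s e.

(** The homotopy vanishes on sets containing [e], so only the removal of [e] contributes. Its two
    signs cancel, and the composite map is the identity since [rho] preserves the components of
    [[G:s]]. *)
Lemma bdry_homotopy_in T s : e \in s -> bdry (homotopy T) s = T s.
Proof.
move=> es; rewrite /bdry (bigD1 e) //= [X in _ + X]big1 => [|f /andP[fs fe]].
  rewrite addr0 /homotopy !inE eqxx /= raddfMz -mulrzA -exprD.
  rewrite (before_setD1 e es) ltnn addn0 sign_addnn mulr1z.
  rewrite setD1K //= tr_comp => [|u w]; last exact/connect_adj_sub/subsetDl.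
  by apply: tr_id => u; apply: connect_adj_sub (rho_connect u); rewrite sub1set.
by rewrite /homotopy !inE eq_sym fe es /= raddf0 mul0rz.
Qed.

(** The cocycle equation at [e |: s], pushed along [rho], expresses the term removing [e], which is
    [tr rho s (T s)], through the other terms; these are the terms of the left side up to sign. *)
Lemma bdry_homotopy_notin T s : s \subset F -> e \notin s ->
  bdry T (e |: s) = 0 -> bdry (homotopy T) s = tr rho s (T s).
Proof.
move=> sF es dT0.
have : tr rho s (bdry T (e |: s)) *~ (-1) ^+ before s e = 0.
  by rewrite dT0 raddf0 mul0rz.
rewrite /bdry big_setU1 //= raddfD mulrzDl => /eqP.
rewrite addr_eq0 raddfMz -mulrzA -exprD before_setU1 // ltnn addn0.
rewrite sign_addnn mulr1z => /eqP dT.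
transitivity (tr rho s (tr id (e |: s) (T ((e |: s) :\ e)))); last first.
  by rewrite setU1K // tr_comp // => u w; apply: rho_adj.
rewrite dT raddf_sum mulrz_suml -sumrN.
apply: eq_bigr => f fs; have fe : f != e by apply: contraNneq es => <-.
rewrite /homotopy !inE (negPf es) andbF [in LHS]raddfMz [X in - (X *~
  _)]raddfMz -!mulrzA -mulrNz.
rewrite (tr_set_eq T rho _ (_ : e |: s :\ f = (e |: s) :\ f)); last first.
  apply/setP => g; rewrite !inE; case: (eqVneq g e) => [->|] //=.
  by rewrite eq_sym fe.
rewrite /= tr_comp => [|u w]; last exact/connect_adj_sub/subsetDl.
rewrite tr_comp => [|u w]; last exact: rho_adj.
rewrite before_setU1 // (before_setD1 e fs); congr (_ *~ _).
rewrite !exprD.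
by case: ltngtP fe => [_|_|/val_inj->]; rewrite ?eqxx // ?expr0 ?expr1 => _;
  ring.
Qed.

Lemma homotopy_exact T :
  (forall s, s \subset F -> bdry T s = 0) ->
  (forall s, s \subset F -> e \notin s -> tr rho s (T s) = T s) ->
  forall s, s \subset F -> bdry (homotopy T) s = T s.
Proof.
move=> dT0 rhoT s sF; have [es|es] := boolP (e \in s).
  exact: bdry_homotopy_in.
by rewrite bdry_homotopy_notin ?rhoT // dT0 // subUset sub1set eF.
Qed.

End Homotopy.

Section Exactness.
Variables (G : mgraph) (A : coefficients G).
Notation V := (vert G).
Notation E := 'I_(nedges G).
Implicit Types (s r F : {set E}) (T Y : family A).

(** Adding a loop does not change connectivity, so [rho = id] satisfies all the conditions. *)
Lemma loop_exact T (e : E) : (ends e).1 = (ends e).2 ->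
  (forall s, bdry T s = 0) -> exists Y, forall s, bdry Y s = T s.
Proof.
move=> loop_e dT0; exists (homotopy e id T) => s.
apply: (@homotopy_exact _ _ setT); rewrite ?inE //; last first.
  by move=> s' _ _; apply: tr_id.
move=> {}s u w _; apply: connect_sub => a b /exists_inP[f].
rewrite !inE => /orP[/eqP->|fs fab]; last by apply/connect1/exists_inP;
  exists f.
rewrite [ends e]surjective_pairing loop_e.
by case/orP => /eqP[-> ->].
Qed.

Definition joins (e : E) (u w : V) :=
  (ends e == (u, w)) || (ends e == (w, u)).

Definition leaf_edge F (e : E) (u w : V) :=
  [/\ e \in F, u != w, joins e u w
    & forall f, f \in F -> ((ends f).1 == w) || ((ends f).2 == w) -> joins f u
      w].

(** Here [rho] folds [w] onto [u]. On sets avoiding [e] the required identity [tr rho s (T s) = T s]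
    reads 0 = 0. *)
Lemma leaf_exact F T e u w : leaf_edge F e u w ->
  (forall s, s \subset F -> bdry T s = 0) ->
  (forall s, s \subset F :\ e -> T s = 0) ->
  exists Y, forall s, s \subset F -> bdry Y s = T s.
Proof.
move=> [eF uw euw leaf] dT0 T0.
exists (homotopy e (fun x => if x == w then u else x) T).
apply: homotopy_exact => //.
- move=> s x y sF; move: x y; apply: connect_homo => a b /exists_inP[f fs fab].
  have fF : f \in F by move: fs; rewrite !inE => /orP[/eqP->|/(subsetP sF)].
  (* An edge at [w] is parallel to [e] and is collapsed by [rho]; any other edge differs from [e],
     hence lies in [s], and its ends are fixed. *)
  have [fw|/norP[f1 f2]] := boolP (((ends f).1 == w) || ((ends f).2 == w)).
    have := leaf f fF fw; rewrite /joins.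
    by case/orP: fab => /eqP->; rewrite !xpair_eqE;
      case/orP=> /andP[/eqP-> /eqP->]; rewrite eqxx (negPf uw).
  have fe : f != e.
    apply: contraNneq f1 => fe; move: f2; rewrite fe.
    by case/orP: euw => /eqP->; rewrite /= eqxx.
  have {}fs : f \in s by move: fs; rewrite !inE (negPf fe).
  have [aw bw] : a != w /\ b != w by case/orP: fab f1 f2 => /eqP->.
  by rewrite (negPf aw) (negPf bw); apply/connect1/exists_inP; exists f.
- move=> a; case: eqP => [->|] //; apply/connect1/exists_inP; exists e => //.
  by rewrite inE.
- by move=> s sF es; rewrite T0 ?raddf0 // subsetD1 sF.
Qed.

(** Induction on [F]: a primitive [Y] of [T] on the subsets of [F :\ e] makes [T - bdry Y] vanish
    there, so [leaf_exact] provides a primitive [Z] of the difference. *)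
Lemma leafy_exact :
  (forall F, F != set0 -> exists e u w, leaf_edge F e u w) ->
  forall F T, T set0 = 0 -> (forall s, s \subset F -> bdry T s = 0) ->
  exists Y, forall s, s \subset F -> bdry Y s = T s.
Proof.
move=> leaves F; have [n] := ubnP #|F|; elim: n F => // n IHn F.
rewrite ltnS => Fn T T0 dT0; have [->|/leaves] := eqVneq F set0.
  exists (fun=> 0) => s; rewrite subset0 => /eqP->.
  by rewrite T0 /bdry big_set0.
case=> e [u [w leaf]]; have eF : e \in F by case: leaf.
have [||s /subsetD1P[sF _]|Y YT] := IHn (F :\ e) _ T.
- by rewrite (leq_trans _ Fn) // [X in (_ < X)%N](cardsD1 e) eF.
- exact: T0.
- exact: dT0.
have [||Z ZT] := @leaf_exact F (fun s => T s - bdry Y s) e u w leaf.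
- by move=> s sF; rewrite bdryB bdry_bdry subr0 dT0.
- by move=> s sF; rewrite YT // subrr.
(* This is [Z + Y], written as a difference so that [bdryB] applies. *)
exists (fun s => Z s - - Y s) => s sF.
rewrite (eq_bdry (Y := fun r => Y r - - Z r)) => [|f _]; last first.
  by rewrite !opprK addrC.
have bdry0 : bdry (fun=> 0 : A _) s = 0.
  by rewrite /bdry big1 // => f _; rewrite raddf0 mul0rz.
rewrite bdryB (eq_bdry (T := fun r => - Z r) (Y := fun r => 0 - Z r)).
  by rewrite bdryB bdry0 sub0r opprK ZT // addrC subrK.
by move=> f _; rewrite sub0r.
Qed.

End Exactness.

(** * Torsion-free cohomology *)

Lemma tens_mulrn_eq0 (K : finType) (t : tens K) m :
  (0 < m)%N -> t *+ m = 0 -> t = 0.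
Proof.
move=> m0 h; apply/ffunP => b; move/ffunP/(_ b): h; rewrite ffunMnE !ffunE.
by move=> /eqP; rewrite mulrn_eq0 eqn0Ngt m0 => /eqP.
Qed.

Lemma cards_setD1 (T : finType) (s : {set T}) x n :
  x \in s -> (#|s :\ x| == n) = (#|s| == n.+1).
Proof. by move=> xs; rewrite (cardsD1 x s) xs. Qed.

Section Cochains.
Variable G : mgraph.
Notation V := (vert G).
Notation E := 'I_(nedges G).

Definition tens_coef : coefficients G :=
  @Coefficients G (fun s => tens (comp s) : zmodType) (@push G) (@pushB G)
    (@push_comp G) (@push_id G) (fun s t => @tens_mulrn_eq0 _ t 2 isT).

(** Extension by zero to all edge sets; [pselect] supplies the proof of cardinality that an index in
    [subsets G i] carries. *)
Definition ext i (t : cochain G i) : family tens_coef := fun s =>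
  if pselect (#|s| == i) is left h then t (exist _ s h) else 0.

Definition restr i (T : family tens_coef) : cochain G i :=
  [ffun s : subsets G i => T (val s) : (tens (comp (val s)) : zmodType)].

Lemma ext_val i (t : cochain G i) (s : subsets G i) : ext t (val s) = t s.
Proof.
case: s => s h; rewrite /ext /=; case: pselect => // h'.
by rewrite (bool_irrelevance h' h).
Qed.

Lemma ext_card i (t : cochain G i) (s : {set E}) : #|s| != i -> ext t s = 0.
Proof. by move=> /negPf h; rewrite /ext; case: pselect => // h';
  rewrite h' in h. Qed.

Lemma ext_restr i T (s : {set E}) : #|s| = i -> ext (restr i T) s = T s.
Proof. by move=> h; move: (introT eqP h) => h';
  rewrite (ext_val _ (exist _ s h')) ffunE. Qed.

(** A pair of a set and a new edge with union [val s] amounts to an edge [e] of [val s], the set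
    being [val s :\ e]. *)
Lemma diffE i (t : cochain G i) (s : subsets G i.+1) :
  diff t s = bdry (ext t) (val s).
Proof.
rewrite ffunE (exchange_big_dep (mem (val s))) /=; last first.
  by move=> r e _ /andP[_ /eqP<-]; rewrite setU11.
apply: eq_bigr => e es.
have card_s : #|val s :\ e| == i by rewrite cards_setD1 ?(valP s).
rewrite (big_pred1 (exist _ (val s :\ e) card_s)) => [|r]; last first.
  apply/andP/eqP => [[er /eqP rs]|->]; last by rewrite /= setD11 setD1K.
  by apply: val_inj; rewrite /= -rs setU1K.
rewrite -ext_val /=; congr (_ *~ (-1) ^+ _).
rewrite /before; apply: eq_card => f; rewrite !inE.
by case: (eqVneq f e) => [->|]; rewrite ?ltnn ?andbF.
Qed.

Lemma ext_diff i (t : cochain G i) s : ext (diff t) s = bdry (ext t) s.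
Proof.
have [/eqP h|h] := eqVneq #|s| i.+1.
  by rewrite (ext_val _ (exist _ s h)) diffE.
rewrite ext_card // /bdry big1 // => e es.
by rewrite ext_card ?raddf0 ?mul0rz // cards_setD1.
Qed.

Lemma diff_restr i T (s : subsets G i.+1) : diff (restr i T) s = bdry T (val s).
Proof.
rewrite diffE; apply: (@eq_bdry _ tens_coef) => e es; apply: ext_restr.
by apply/eqP; rewrite cards_setD1 ?(valP s).
Qed.

Lemma diff_diff i (t : cochain G i) : diff (diff t) = 0.
Proof.
apply/ffunP => s; rewrite diffE ffunE.
rewrite -[RHS](bdry_bdry (ext t) (val s));
  apply: (@eq_bdry _ tens_coef) => e es.
by rewrite ext_diff.
Qed.

Lemma cochain_eq0 i (t : cochain G i) m : (0 < m)%N -> t *+ m = 0 -> t = 0.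
Proof.
move=> m0 h; apply/ffunP => s; rewrite ffunE; apply: (tens_mulrn_eq0 m0).
have -> : t s *+ m = (t *+ m) s.
  by elim: (m) => [|k IHk]; rewrite ?mulr0n ?ffunE // !mulrS IHk ffunE.
by rewrite h ffunE.
Qed.

Lemma acyclic i :
  (exists e : E, (ends e).1 = (ends e).2) \/
  (forall F, F != set0 -> exists e u w, @leaf_edge G F e u w) ->
  forall t : cochain G i.+1, diff t = 0 -> exists y, diff y = t.
Proof.
move=> hG t dt0.
have dT0 s : bdry (ext t) s = 0.
  rewrite -ext_diff dt0 /ext; by case: pselect => // h; rewrite ffunE.
have [Y YT] : exists Y, forall s, bdry Y s = ext t s.
  case: hG => [[e loop_e]|leaves]; first exact: (loop_exact loop_e).
  have [||Y YT] := @leafy_exact _ _ leaves setT (ext t).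
  (* Positive degree enters here: the empty set does not have [i.+1] elements. *)
  - by apply: ext_card; rewrite cards0.
  - by move=> s _; apply: dT0.
  - by exists Y => s; apply: YT.
exists (restr i Y); apply/ffunP => s.
by rewrite diff_restr YT ext_val.
Qed.

Lemma coh_class_eq0 i (z : cocycle G i) :
  coh_class z = 0 <-> is_coboundary (val z).
Proof.
have <- : coh_class (0 : cocycle G i) = 0 by rewrite /coh_class raddf0.
split=> [/eqP|hz]; last apply/eqP.
  by rewrite /coh_class -Quotient.idealrBE subr0 inE => /asboolP.
by rewrite /coh_class -Quotient.idealrBE subr0 inE; apply/asboolP.
Qed.

Lemma coh_classP i (h : coh G i) : exists z, h = coh_class z.
Proof. by exists (repr h); rewrite /coh_class reprK. Qed.

(** In positive degree the group is zero by [acyclic]. In degree 0 the only coboundary is 0, so a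
    torsion class would be a torsion cochain. *)
Lemma coh_torsion_free i :
  (exists e : E, (ends e).1 = (ends e).2) \/
  (forall F, F != set0 -> exists e u w, @leaf_edge G F e u w) ->
  forall (h : coh G i) m, (0 < m)%N -> h *+ m = 0 -> h = 0.
Proof.
move=> hG h m m0; have [z ->] := coh_classP h.
case: i h z => [|i] h z; last first.
  by move=> _; apply/coh_class_eq0/acyclic/eqP => //; apply: (valP z).
rewrite (_ : coh_class z *+ m = coh_class (z *+ m)); last first.
  by rewrite /coh_class raddfMn.
move=> /coh_class_eq0; rewrite raddfMn => zm; apply/coh_class_eq0.
exact: cochain_eq0 m0 zm.
Qed.
End Cochains.

(** * Cycles and leaf edges *)

Section Cycles.
Variable G : mgraph.
Notation V := (vert G).
Notation E := 'I_(nedges G).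
Implicit Types (F : {set E}) (e f : E) (u w : V).
Hypothesis noloop : loopless G.

(** Without a leaf edge every path extends at its head [x]: some edge at [x] is not parallel to the
    first edge of the path, and its other end [z] is new, since otherwise it closes a cycle of
    length at least 3. Paths would then outgrow [V]. *)
Lemma acyclic_leaf F : (forall k, (3 <= k)%N -> ~ has_cycle G k) ->
  F != set0 -> exists e u w, leaf_edge F e u w.
Proof.
move=> nocycle /set0Pn[e0 e0F]; apply: contrapT => noleaf.
have long n : exists x p, [/\ uniq (x :: p), path (adj F) x p & size p = n.+1].
  elim: n => [|n [x [p [xuq pq sq]]]].
    exists (ends e0).1, [:: (ends e0).2]; split=> //=.
      by rewrite inE noloop.
    by rewrite andbT; apply/exists_inP; exists e0;
      rewrite // -surjective_pairing eqxx.
  case: p xuq pq sq => [|u q] // xuq pq [sq].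
  have /andP[/exists_inP[e eF xu] _] := pq.
  have xNu : u != x by apply: contraTneq xuq => ->; rewrite /= inE eqxx.
  have [/forall_inP all_u|] := boolP [forall f in F,
      ((ends f).1 == x) || ((ends f).2 == x) ==> joins f u x].
    case: noleaf; exists e, u, x; split=> // [|f fF fx];
      first by rewrite /joins orbC.
    by have := all_u f fF; rewrite fx.
  rewrite negb_forall_in => /exists_inP[f fF];
    rewrite negb_imply => /andP[fx fu].
  have [z fz] : exists z, joins f x z.
    case/orP: fx => /eqP fx; [exists (ends f).2|exists (ends f).1];
      by rewrite /joins -fx -surjective_pairing eqxx ?orbT.
  have zx : z != x.
    apply: contraTneq (noloop f) => zx; rewrite negbK.
    by move: fz; rewrite zx /joins orbb => /eqP->.
  have zu : z != u by apply: contraNneq fu => <-; rewrite /joins orbC.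
  have [zq|zq] := boolP (z \in q); last first.
    exists z, [:: x, u & q]; split; rewrite /= ?sq //.
      by move: xuq => /= ->; rewrite !inE !negb_or zx zu zq.
    by move: pq => /= ->; rewrite andbT; apply/exists_inP; exists f;
      rewrite // orbC.
  case/splitPr: q / zq xuq pq {sq} => q1 q2.
  have uE : u :: q1 ++ z :: q2 = (u :: rcons q1 z) ++ q2 by rewrite /=
    cat_rcons.
  rewrite uE cat_path -cat_cons cat_uniq => /andP[uq1 _] /andP[pq1 _].
  case: (nocycle (size [:: x, u & rcons q1 z])); first by rewrite /= size_rcons.
  exists [:: x, u & rcons q1 z] => //; rewrite /ucycle uq1 andbT.
  rewrite /cycle rcons_path /=; apply/andP; split.
    apply: sub_path pq1 => a b /exists_inP[g _ gab].
    by apply/exists_inP; exists g; rewrite ?inE.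
  by rewrite last_rcons; apply/exists_inP; exists f; rewrite ?inE // orbC.
have [x [p [xp _ sp]]] := long #|V|.
by have := max_card (mem (x :: p)); rewrite (card_uniqP xp) /= sp ltnNge leqnSn.
Qed.

Definition endset e : {set V} := [set (ends e).1; (ends e).2].

Lemma joins_endset e u w : joins e u w -> endset e = [set u; w].
Proof. by case/orP => /eqP; rewrite /endset => ->; rewrite //= setUC. Qed.

Lemma next_next_neq (p : seq V) u :
  uniq p -> (3 <= size p)%N -> u \in p -> next p (next p u) != u.
Proof.
move=> up sp /rot_to[i q pq].
rewrite -!(next_rot i up).
have : uniq (rot i p) by rewrite rot_uniq.
have : (3 <= size (rot i p))%N by rewrite size_rot.
rewrite pq; case: q {pq} => [|v [|w q]] //= _.
rewrite !inE eqxx !negb_or => /andP[/and3P[uv uw _] _].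
by rewrite (eq_sym v) (negPf uv) eqxx eq_sym.
Qed.

(** One edge is chosen from each vertex of the cycle to its successor. Every vertex of the cycle is
    an end of exactly two of these edges, so the sum is twice that of [g] over the cycle. *)
Lemma cycle_edge_set k : (3 <= k)%N -> has_cycle G k ->
  exists C : {set E}, [/\ #|C| = k, {in C &, injective endset} &
    forall g : V -> int,
      (2 %| \sum_(f in C) (g (ends f).1 + g (ends f).2))%Z].
Proof.
move=> k3 [p /andP[cp up] sp].
have edge u : u \in p -> exists e, joins e u (next p u).
  by move=> /(next_cycle cp)/exists_inP[e _]; exists e.
(* A default value for the chosen edge at vertices off the cycle. *)
have [e0 _] : exists e0 : E, true.
  case: p cp up sp edge => [|u p] _ _ sp edge; first by rewrite -sp in k3.
  by have [|e _] := edge u; [rewrite mem_head|exists e].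
have {edge}/choice[ed edP] : forall u, exists e, u \in p -> joins e u (next p
  u).
  move=> u; have [/edge[e]|_] := boolP (u \in p); first by exists e.
  by exists e0.
(* Two distinct vertices with the same chosen pair of ends would be successors of each other, which
   needs a cycle of length 2. *)
have inj u u' : u \in p -> u' \in p -> endset (ed u) = endset (ed u') -> u = u'.
  move=> /[dup] pu /edP/joins_endset-> /[dup] pu' /edP/joins_endset-> uu'.
  have : u \in [set u'; next p u'] by rewrite -uu' !inE eqxx.
  have : u' \in [set u; next p u] by rewrite uu' !inE eqxx.
  rewrite !inE => /orP[/eqP->//|/eqP u'E] /orP[/eqP->//|/eqP uE].
  have := next_next_neq up _ pu; rewrite sp => /(_ k3).
  by rewrite -u'E -uE eqxx.
have ed_inj : {in p &, injective ed}.
  by move=> u u' pu pu' uu'; apply: inj => //; rewrite uu'.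
exists [set ed u | u in p]; split.
- by rewrite card_in_imset // (card_uniqP up).
- by move=> _ _ /imsetP[u pu ->] /imsetP[u' pu' ->] /(inj _ _ pu pu') ->.
- move=> g; rewrite big_imset //=;
  have -> : \sum_(u in p) (g (ends (ed u)).1 + g (ends (ed u)).2)
    = \sum_(u in p) (g u + g (next p u)).
    by apply: eq_bigr => u /edP /orP[] /eqP-> //=; rewrite addrC.
  apply/dvdzP; exists (\sum_(u in p) g u);
    rewrite big_split mulr2n mulrDr mulr1 /=.
  congr (_ + _); rewrite [RHS](reindex_onto (next p) (prev p)) => [|u _];
    last exact: next_prev.
  by apply: eq_bigl => u /=; rewrite mem_next prev_next // eqxx andbT.
Qed.

End Cycles.

(** * Merging two tensor factors *)

Section MergeTwo.
Variables (K L : finType) (phi : K -> L) (ka kb : K).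

(** The two hypotheses below make [phi] the quotient map identifying [ka] with [kb]; the case
    [ka = kb] models an edge inside one component. *)
Definition merge k := if k == kb then ka else k.

Hypothesis phi_merge : forall k k', (phi k == phi k') = (merge k == merge k').
Hypothesis phi_surj : forall l, exists k, phi k = l.

Lemma merge_id : ka = kb -> merge =1 id.
Proof. by move=> kab k; rewrite /merge; case: eqP => // ->. Qed.

Lemma merge_inj : ka = kb -> injective phi.
Proof.
by move=> kab k k' /eqP; rewrite phi_merge !merge_id // => /eqP.
Qed.

Lemma card_merge_same : ka = kb -> #|K| = #|L|.
Proof.
move=> kab; rewrite -(card_codom (merge_inj kab)); apply: eq_card => l.
by have [k <-] := phi_surj l; rewrite inE codom_f.
Qed.

Lemma card_merge : ka != kb -> #|K| = #|L|.+1.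
Proof.
move=> kab; rewrite (_ : #|L| = #|[set~ kb]|).
  by rewrite cardsC1 prednK //; apply/card_gt0P; exists ka.
rewrite -(@card_in_imset _ _ phi) => [|k k']; last first.
  rewrite !inE => /negPf hk /negPf hk' /eqP.
  by rewrite phi_merge /merge hk hk' => /eqP.
rewrite -cardsT; apply: eq_card => l; rewrite inE; apply/esym/imsetP.
have [k <-] := phi_surj l; exists (merge k).
  by rewrite !inE /merge; case: (eqVneq k kb).
by apply/eqP; rewrite phi_merge /merge; case: (eqVneq k kb) => [_|/negPf->] //;
  rewrite (negPf kab).
Qed.

Lemma pushes_same b c : ka = kb ->
  pushes phi b c = (b == [ffun k => c (phi k)]).
Proof.
move=> kab.
have fiber k : (\sum_(k' | phi k' == phi k) b k')%N = b k.
  by apply: big_pred1 => k'; apply/eqP/eqP => [/(merge_inj kab)|->].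
apply/forallP/eqP => [h|->].
  by apply/ffunP => k; apply: val_inj; move: (h (phi k));
    rewrite fiber ffunE => /eqP.
move=> l; have [k <-] := phi_surj l.
rewrite (big_pred1 k) ?ffunE // => k'.
by apply/eqP/eqP => [/(merge_inj kab)|->].
Qed.

(** The labels of x (x) ... (x) x; [zero_at] below replaces one factor by 1. *)
Definition ones (M : finType) : {ffun M -> 'I_2} := [ffun=> ord_max].

Definition zero_at (M : finType) (m : M) : {ffun M -> 'I_2} :=
  [ffun m' => if m' == m then ord0 else ord_max].

Lemma sum_zero_at (M : finType) (m : M) : (\sum_k zero_at m k).+1 = #|M|.
Proof.
rewrite (bigD1 m) //= ffunE eqxx add0n.
rewrite (eq_bigr (fun=> 1%N)) => [|k /negPf km]; last by rewrite ffunE km.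
by rewrite sum1_card cardC1 prednK //; apply/card_gt0P; exists m.
Qed.

(** The merged factor equals [x] only as 1 times [x] or [x] times 1, and all other factors must
    already be [x]. *)
Lemma pushes_ones b : ka != kb ->
  pushes phi b (ones L) = (b == zero_at ka) || (b == zero_at kb).
Proof.
move=> kab.
have kba : kb != ka by rewrite eq_sym.
have phiab : phi kb = phi ka.
  by apply/eqP; rewrite phi_merge /merge eqxx (negPf kab).
have fiber_ab (b' : {ffun K -> 'I_2}) :
    (\sum_(k | phi k == phi ka) b' k)%N = (b' ka + b' kb)%N.
  rewrite (bigD1 ka) //= (big_pred1 kb) // => k /=.
  rewrite phi_merge /merge (negPf kab).
  case: (eqVneq k kb) => [->|_]; last by rewrite andbN.
  by rewrite eqxx eq_sym kab.
have fiber (b' : {ffun K -> 'I_2}) k0 : k0 != ka -> k0 != kb ->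
    (\sum_(k | phi k == phi k0) b' k)%N = b' k0.
  move=> k0a /negPf k0b; apply: big_pred1 => k /=; rewrite phi_merge /merge k0b.
  case: (eqVneq k kb) => [->|//].
  by rewrite ![_ == k0]eq_sym (negPf k0a) k0b.
apply/forallP/idP => [h|hb l].
  have hab := h (phi ka); rewrite fiber_ab ffunE /= in hab.
  have b1 k : k != ka -> k != kb -> b k = ord_max.
    move=> hka hkb; apply: val_inj; move: (h (phi k)).
    by rewrite fiber // ffunE => /eqP.
  have : (b ka == ord0) && (b kb == ord_max) || (b ka == ord_max) && (b kb ==
    ord0).
    by move: hab; case: (b ka) => [[|[]]] // ?; case: (b kb) => [[|[]]].
  case/orP=> /andP[/eqP ba /eqP bb]; apply/orP; [left|right];
    apply/eqP/ffunP => k; rewrite ffunE.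
    case: (eqVneq k ka) => [->//|hka].
    by case: (eqVneq k kb) => [->//|hkb]; apply: b1.
  case: (eqVneq k kb) => [->//|hkb].
  by case: (eqVneq k ka) => [->//|hka]; apply: b1.
have [k0 <-] := phi_surj l; rewrite ffunE.
have [->|k0a] := eqVneq k0 ka.
  by rewrite fiber_ab; case/orP: hb => /eqP->;
    rewrite !ffunE eqxx ?(negPf kab) ?(negPf kba).
have [->|k0b] := eqVneq k0 kb.
  by rewrite phiab fiber_ab; case/orP: hb => /eqP->;
    rewrite !ffunE eqxx ?(negPf kab) ?(negPf kba).
by rewrite fiber //; case/orP: hb => /eqP->;
  rewrite !ffunE ?(negPf k0a) ?(negPf k0b).
Qed.

Lemma tens_map_ones (t : tens K) : ka != kb ->
  tens_map phi t (ones L) = t (zero_at ka) + t (zero_at kb).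
Proof.
move=> kab; rewrite tens_mapE (bigD1 (zero_at ka)) /=; last first.
  by rewrite pushes_ones ?eqxx.
rewrite (big_pred1 (zero_at kb)) // => b; rewrite pushes_ones //=.
have zab : zero_at ka != zero_at kb.
  by apply/eqP => /ffunP/(_ ka); rewrite !ffunE eqxx (negPf kab).
by case: (eqVneq b (zero_at kb)) => [->|];
  rewrite ?orbF ?andbN // eq_sym zab orbT.
Qed.

(* Label 0 stands for the factor 1 and label 1 for x, so this is the sum of the
   basis tensors with one factor 1 and all the others x. *)
Definition one_unit (M : finType) : tens M :=
  [ffun b : {ffun M -> 'I_2} => ((\sum_k b k).+1 == #|M|)%:R : int].

Lemma one_unit_zero_at (M : finType) (m : M) : one_unit M (zero_at m) = 1.
Proof. by rewrite ffunE sum_zero_at eqxx. Qed.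

Lemma tens_map_one_unit_same c : ka = kb ->
  tens_map phi (one_unit K) c = one_unit L c.
Proof.
move=> kab; rewrite tens_mapE (big_pred1 [ffun k => c (phi k)]); last first.
  by move=> b; apply: pushes_same.
rewrite !ffunE (card_merge_same kab) (@pushes_degree _ _ phi _ c) //.
by rewrite pushes_same.
Qed.

(** Merging lowers the number of factors by one, so the image lies in the top degree [#|L|], spanned
    by x (x) ... (x) x, whose coefficient is 1 + 1. *)
Lemma tens_map_one_unit_even c : ka != kb ->
  (2 %| tens_map phi (one_unit K) c)%Z.
Proof.
move=> kab; have [->|c1] := eqVneq c (ones L).
  by rewrite tens_map_ones // !one_unit_zero_at.
rewrite tens_mapE big1 // => b /pushes_degree bc; rewrite ffunE bc.
rewrite (card_merge kab) eqSS; case: eqP => // cL; case/eqP: c1.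
have : (\sum_l (1 - c l) = 0)%N.
  rewrite sumnB => [|l _]; last by rewrite -ltnS.
  by rewrite sum1_card cL subnn.
move/eqP; rewrite sum_nat_eq0 => /forallP h; apply/ffunP => l; apply: val_inj.
move: (h l) (ltn_ord (c l)); rewrite ffunE /= subn_eq0.
by case: (val (c l)) => [|[|]].
Qed.

End MergeTwo.

Lemma connect_invariant (T : finType) (S : eqType) (e : rel T) (h : T -> S) :
  (forall x y, e x y -> h x = h y) -> forall x y, connect e x y -> h x = h y.
Proof.
move=> he x y /connectP[p]; elim: p x => [|z p IHp] x /=; first by move=> _ ->.
by case/andP=> /he -> /(IHp z).
Qed.

(** * Per-edge maps as mergers of components *)

Section EdgeMaps.
Variable G : mgraph.
Notation V := (vert G).
Notation E := 'I_(nedges G).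
Implicit Types (s : {set E}) (e f : E) (T : family (tens_coef G)).

Definition bridges s e : bool := ~~ connect (adj (s :\ e)) (ends e).1 (ends
  e).2.

Section OneEdge.
Variables (s : {set E}) (e : E).
Hypothesis es : e \in s.

Let phi (k : comp (s :\ e)) : comp s := comp_of s (val k).
Let ka := comp_of (s :\ e) (ends e).1.
Let kb := comp_of (s :\ e) (ends e).2.

Let bridgesE : bridges s e = (ka != kb).
Proof. by rewrite comp_of_eq. Qed.

Let phi_comp_of u : phi (comp_of (s :\ e) u) = comp_of s u.
Proof.
apply/eqP; rewrite comp_of_eq adj_connect_sym /=.
exact/(connect_adj_sub (subsetDl s [set e]))/connect_root.
Qed.

Let phi_surj l : exists k, phi k = l.
Proof. by exists (comp_of _ (val l)); rewrite phi_comp_of comp_of_val. Qed.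

(** The merged component of a vertex is constant along the edges of [s]: [e] joins the two merged
    components, and every other edge survives in [s :\ e]. *)
Let phi_merge k k' : (phi k == phi k') = (merge ka kb k == merge ka kb k').
Proof.
apply/idP/eqP => [|].
  rewrite comp_of_eq => kk'.
  suff : merge ka kb (comp_of (s :\ e) (val k))
         = merge ka kb (comp_of (s :\ e) (val k')) by rewrite !comp_of_val.
  move: (val k) (val k') kk'.
  apply: (@connect_invariant _ _ _ (fun u => merge ka kb (comp_of (s :\ e) u))).
  move=> u w /exists_inP[f fs fuw].
  have [fe|fe] := eqVneq f e.
    by case/orP: fuw; rewrite fe => /eqP eE;
       rewrite /merge /ka /kb eE /= eqxx; case: ifP.
  congr merge; apply/eqP; rewrite comp_of_eq.
  by apply/connect1/exists_inP; exists f; rewrite // !inE fe.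
have phi_merged j : phi (merge ka kb j) = phi j.
  rewrite /merge; case: eqP => // ->; rewrite /ka /kb !phi_comp_of.
  apply/eqP; rewrite comp_of_eq; apply/connect1/exists_inP; exists e => //.
  by rewrite -surjective_pairing eqxx.
by move=> kk'; rewrite -(phi_merged k) kk' phi_merged.
Qed.

Lemma card_comp_bridge : bridges s e -> #|comp (s :\ e)| = #|comp s|.+1.
Proof. by rewrite bridgesE => /(card_merge phi_merge phi_surj). Qed.

Lemma push_ones (t : tens (comp (s :\ e))) : bridges s e ->
  push id s t (ones (comp s)) = t (zero_at ka) + t (zero_at kb).
Proof. by rewrite bridgesE; apply: tens_map_ones phi_merge phi_surj t. Qed.

Lemma push_one_unit_even c : bridges s e ->
  (2 %| push id s (one_unit (comp (s :\ e))) c)%Z.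
Proof. by rewrite bridgesE;
  apply: tens_map_one_unit_even phi_merge phi_surj c. Qed.

Lemma push_one_unit_same c : ~~ bridges s e ->
  push id s (one_unit (comp (s :\ e))) c = one_unit (comp s) c.
Proof.
rewrite bridgesE negbK => /eqP.
exact: tens_map_one_unit_same phi_merge phi_surj c.
Qed.

End OneEdge.

Lemma bdry_coef T s (c : {ffun comp s -> 'I_2}) :
  (bdry T s : tens (comp s)) c =
  \sum_(e in s) (push id s (T (s :\ e) : tens _) : tens _) c * (-1) ^+ before s
    e.
Proof.
rewrite /bdry (@big_morph _ _ (fun t : tens (comp s) => t c) 0 +%R 0 +%R).
- by apply: eq_bigr => e _; rewrite ffunMzE mulrzz.
- by move=> t t'; rewrite ffunE.
- by rewrite ffunE.
Qed.

Definition unit_coef T s (u : V) : int :=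
  (T s : tens (comp s)) (zero_at (comp_of s u)).

Definition ones_coef T s : int := (T s : tens (comp s)) (ones (comp s)).

Lemma bdry_ones T s : {in s, forall e, bridges s e} ->
  ones_coef (bdry T) s = \sum_(e in s)
    (unit_coef T (s :\ e) (ends e).1 + unit_coef T (s :\ e) (ends e).2)
      * (-1) ^+ before s e.
Proof.
move=> hs; rewrite /ones_coef bdry_coef; apply: eq_bigr => e es.
by rewrite push_ones // hs.
Qed.

Lemma bdry_homog (j : nat) T s (c : {ffun comp s -> 'I_2}) :
  (forall e (b : {ffun comp (s :\ e) -> 'I_2}), e \in s ->
     (T (s :\ e) : tens _) b != 0 -> (\sum_k b k)%N = j) ->
  (bdry T s : tens (comp s)) c != 0 -> (\sum_k c k)%N = j.
Proof.
move=> hT; rewrite bdry_coef => c0.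
have [/exists_inP[e es]|/exists_inPn none] := boolP [exists e in s,
    (push id s (T (s :\ e) : tens _) : tens _) c != 0]; last first.
  case/eqP: c0; apply: big1 => e /none; rewrite negbK => /eqP->.
  by rewrite mul0r.
rewrite tens_mapE => c0'.
have [/exists_inP[b bc b0]|/exists_inPn none] := boolP [exists b in
    pushes (fun k : comp (s :\ e) => comp_of s (val k)) ^~ c,
    (T (s :\ e) : tens _) b != 0].
  by rewrite -(pushes_degree bc) (hT e).
case/eqP: c0'; apply: big1 => b bc; apply/eqP; rewrite -[_ == _]negbK.
exact: none.
Qed.

End EdgeMaps.

(** * Elements of order two *)

Section TwoTorsion.
Variable G : mgraph.
Notation V := (vert G).
Notation E := 'I_(nedges G).
Implicit Types (e f : E) (T : family (tens_coef G)).

Lemma homog_diff i j (y : cochain G i) : homog j y -> homog j (diff y).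
Proof.
move=> hy s b; rewrite diffE; apply: bdry_homog => e c es.
have hs : #|val s :\ e| == i by rewrite cards_setD1 ?(valP s).
have := hy (exist (fun r : {set E} => #|r| == i) _ hs) c; rewrite -ext_val;
  exact.
Qed.

Lemma diffD i : {morph @diff G i : t u / t + u}.
Proof.
move=> t u; rewrite -[u in LHS]opprK diffB -[- u]sub0r diffB diff0 sub0r.
by rewrite opprK.
Qed.

(** The class is that of [z = diff y / 2]. It is a cocycle because cochains have no 2-torsion; if it
    were [diff w], then [h (diff y) = 2 * h (diff w)] would be divisible by 4. *)
Lemma coh_2torsion i j (y : cochain G i) (h : cochain G i.+1 -> int) :
  homog j y -> (forall (s : subsets G i.+1) b, (2 %| diff y s b)%Z) ->
  {morph h : t u / t + u} -> (forall w, (2 %| h (diff w))%Z) ->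
  ~~ (4 %| h (diff y))%Z -> has_2torsion (coh_deg G i.+1 j).
Proof.
move=> homog_y even_dy hD h_even h_dy.
pose half (t : cochain G i.+1) : cochain G i.+1 :=
  [ffun s => [ffun b => (t s b %/ 2)%Z] : (tens (comp (val s)) : zmodType)].
have halfE t (s : subsets G i.+1) b : half t s b = (t s b %/ 2)%Z.
  by rewrite !ffunE.
pose z := half (diff y); have zz : z + z = diff y.
  apply/ffunP => s; apply/ffunP => b; rewrite -[RHS](divzK (even_dy s b)).
  rewrite ffunE [LHS]ffunE halfE; ring.
have cocycle_z : z \in @cocycle_pred G i.+1.
  by rewrite inE; apply/eqP/(@cochain_eq0 _ _ _ 2);
    rewrite // mulr2n -diffD zz diff_diff.
pose Z : cocycle G i.+1 := exist _ z cocycle_z.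
have homog_z : homog j z.
  move=> s b zsb; apply: (homog_diff homog_y (s := s)).
  by apply: contra zsb => /eqP dy0; rewrite halfE dy0.
have Z_deg : coh_class Z \in @coh_deg_pred G i.+1 j.
  by rewrite inE; apply/asboolP; exists Z.
exists (exist _ (coh_class Z) Z_deg); split.
  move=> /(congr1 val) /= /coh_class_eq0[w /= dw].
  have /dvdzP[m hm] := h_even w.
  case/negP: h_dy; rewrite -zz hD -dw hm; apply/dvdzP; exists m; ring.
apply: val_inj; rewrite raddfMn /= -[_ *+ 2]raddfMn; apply/coh_class_eq0.
by exists y; rewrite raddfMn mulr2n.
Qed.

Lemma dsumMn (I : finType) (M : I -> zmodType) (t : dsum M) m i :
  (t *+ m) i = t i *+ m.
Proof. by elim: m => [|m IHm]; rewrite ?mulr0n ?ffunE // !mulrS ffunE IHm. Qed.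

Lemma coh_total_torsion i j : (i <= nedges G)%N -> (j <= #|V|)%N ->
  has_2torsion (coh_deg G i j) -> has_torsion (coh_total G).
Proof.
move=> iE jV [h [h0 h2]].
pose ij : 'I_(nedges G).+1 * 'I_#|V|.+1 := (Ordinal (iE : (i < _.+1)%N),
  Ordinal (jV : (j < _.+1)%N)).
pose M (ij : 'I_(nedges G).+1 * 'I_#|V|.+1) : zmodType := coh_deg G ij.1 ij.2.
pose t : dsum M := finfun (dfwith (fun k => 0 : M k) (h : M ij)).
have tij : t ij = h by rewrite ffunE dfwith_in.
exists t; split; first by move=> t0; apply: h0; rewrite -tij t0 ffunE.
exists 2 => //; apply/ffunP => k; rewrite dsumMn [in RHS]ffunE.
have [<-|ijk] := eqVneq ij k; first by rewrite tij.
by rewrite ffunE dfwith_out // mul0rn.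
Qed.

Lemma coh_total_torsion_free :
  (forall i (h : coh G i) m, (0 < m)%N -> h *+ m = 0 -> h = 0) ->
  ~ has_torsion (coh_total G).
Proof.
move=> tf [t [t0 [m m0 tm]]]; apply: t0; apply/ffunP => ij; rewrite [RHS]ffunE.
have tijm : t ij *+ m = 0 by rewrite -[LHS](dsumMn t) tm ffunE.
apply: val_inj; apply: tf m0 _.
by rewrite -[LHS](raddfMn val) tijm raddf0.
Qed.

End TwoTorsion.

(** * Torsion classes from odd and even cycles *)

Section CycleTorsion.
Variable G : mgraph.
Notation V := (vert G).
Notation E := 'I_(nedges G).
Implicit Types (s C : {set E}) (e f : E) (T : family (tens_coef G)).
Hypothesis noloop : loopless G.

Lemma connect_set0 (u w : V) : connect (adj (set0 : {set E})) u w -> u = w.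
Proof.
apply: (@connect_invariant _ _ _ id) => a b /exists_inP[f].
by rewrite inE.
Qed.

Lemma connect_set1 e f :
  connect (adj [set e]) (ends f).1 (ends f).2 = (endset e == endset f).
Proof.
apply/idP/eqP => [ef|ef].
  (* Collapsing the ends of [e] is invariant under connectivity in [[G:{e}]], and distinct vertices
     identified by [q] are both ends of [e]. *)
  pose q u := if u \in endset e then (ends e).1 else u.
  have : q (ends f).1 = q (ends f).2.
    apply: connect_invariant ef => a b /exists_inP[g]; rewrite inE => /eqP->.
    by rewrite /q; case/orP=> /eqP eE; rewrite /endset eE !inE !eqxx !orbT.
  have f12 := noloop f; rewrite /q.
  case: ifPn => [f1|f1]; case: ifPn => [f2|f2] qf.
  - apply/eqP; rewrite eq_sym eqEcard !cards2 f12 noloop leqnn andbT.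
    by apply/subsetP => u; rewrite !inE => /orP[] /eqP->; rewrite -?in_set2.
  - by rewrite -qf !inE eqxx in f2.
  - by rewrite qf !inE eqxx in f1.
  - by rewrite qf eqxx in f12.
have f1 : (ends f).1 \in endset e by rewrite ef !inE eqxx.
have f2 : (ends f).2 \in endset e by rewrite ef !inE eqxx orbT.
have f12 := noloop f; apply/connect1/exists_inP; exists e; rewrite ?inE //.
rewrite [ends e]surjective_pairing !xpair_eqE.
move: f1 f2 f12; rewrite !inE.
by case/orP=> /eqP->; case/orP=> /eqP->; rewrite ?eqxx ?orbT.
Qed.

Lemma setU1K_pair e f : e != f -> [set e; f] :\ e = [set f].
Proof. by move=> ef; rewrite setU1K // inE. Qed.

Lemma set_pairK e f : e != f -> [set e; f] :\ f = [set e].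
Proof. by move=> ef; rewrite setUC setU1K // inE eq_sym. Qed.

Definition one_units : family (tens_coef G) := fun s => one_unit (comp s).

Lemma unit_coef_one_units s u : unit_coef one_units s u = 1.
Proof. exact: one_unit_zero_at. Qed.

Lemma ones_coef_extD i (t u : cochain G i) s :
  ones_coef (ext (t + u)) s = ones_coef (ext t) s + ones_coef (ext u) s.
Proof. by rewrite /ones_coef /ext; case: pselect => h; rewrite !ffunE. Qed.

Lemma ones_coef_diff i (t : cochain G i) s :
  ones_coef (ext (diff t)) s = ones_coef (bdry (ext t)) s.
Proof. by rewrite /ones_coef ext_diff. Qed.

Lemma unit_coef_restr i T s u :
  #|s| = i -> unit_coef (ext (restr i T)) s u = unit_coef T s u.
Proof. by move=> si; rewrite /unit_coef ext_restr. Qed.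

Lemma bridges_set1 e : bridges [set e] e.
Proof.
rewrite /bridges setDv; apply/negP => /connect_set0 /eqP.
by rewrite (negPf (noloop e)).
Qed.

Lemma card_comp_set0 : #|comp (set0 : {set E})| = #|V|.
Proof.
rewrite -(card_codom (f := comp_of (set0 : {set E}))).
  by apply: eq_card => k; rewrite inE -[k]comp_of_val codom_f.
by move=> u w /eqP; rewrite comp_of_eq => /connect_set0.
Qed.

Lemma card_comp_set1 e : #|comp [set e]| = (#|V| - 1)%N.
Proof.
have := card_comp_bridge (set11 e) (bridges_set1 e).
by rewrite setDv card_comp_set0 => ->; rewrite subn1.
Qed.

Lemma bdry_ones_set1 T e : ones_coef (bdry T) [set e]
  = unit_coef T set0 (ends e).1 + unit_coef T set0 (ends e).2.
Proof.
rewrite bdry_ones => [|f /set1P->]; last exact: bridges_set1.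
rewrite big_set1 setDv /before (_ : [set f in _ | _] = set0) ?cards0 ?mulr1 //.
by apply/setP => f; rewrite !inE; case: eqP => // ->; rewrite ltnn.
Qed.

(** Non-parallel edges are both bridges of their pair; adding the later edge [f] to [[set e]]
    carries the sign -1. *)
Lemma bdry_ones_set2 T e f : (e < f)%N -> endset e != endset f ->
  ones_coef (bdry T) [set e; f]
  = (unit_coef T [set f] (ends e).1 + unit_coef T [set f] (ends e).2)
    - (unit_coef T [set e] (ends f).1 + unit_coef T [set e] (ends f).2).
Proof.
move=> ef efset; have eNf : e != f by rewrite neq_ltn ef.
rewrite bdry_ones => [|g /set2P[]->]; last 2 first.
- by rewrite /bridges setU1K_pair // connect_set1 eq_sym.
- by rewrite /bridges set_pairK // connect_set1.
rewrite big_setU1 ?inE //= big_set1 setU1K_pair // set_pairK //.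
rewrite (before_setD1 (e := f)) ?inE ?eqxx ?orbT // set_pairK //.
rewrite (before_setD1 (s := [set e; f]) (e := e)) ?inE ?eqxx // setU1K_pair //.
have before1 g : before [set g] g = 0%N.
  apply/eqP; rewrite cards_eq0; apply/eqP/setP => g'; rewrite !inE.
  by case: eqP => // ->; rewrite ltnn.
by rewrite !before1 ef ltnNge (ltnW ef) mulr1 expr1 mulrN1.
Qed.

Lemma odd_cycle_2torsion k : odd k -> (3 <= k)%N -> has_cycle G k ->
  has_2torsion (coh_deg G 1 (#|V| - 1)).
Proof.
move=> odd_k k3 /(cycle_edge_set k3)[C [card_C _ C_even]].
apply: (@coh_2torsion _ 0 _ (restr 0 one_units)
  (fun t => \sum_(e in C) ones_coef (ext t) [set e])).
- move=> s b; rewrite !ffunE pnatr_eq0 eqb0 negbK => /eqP.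
  have s0 : val s = set0 by apply/eqP; rewrite -cards_eq0 (valP s).
  by rewrite (_ : #|comp _| = #|V|) => [<-|];
    rewrite ?subn1 // s0 card_comp_set0.
- move=> s b; have /cards1P[e se] := valP s.
  rewrite diff_restr bdry_coef; apply: rpred_sum => f fs.
  apply: dvdz_mulr; apply: push_one_unit_even => //.
  by move: fs; rewrite se inE => /eqP->; apply: bridges_set1.
- by move=> t u; rewrite -big_split; apply: eq_bigr => e _;
  apply: ones_coef_extD.
(* Here [C_even] is applied to the function taking a vertex to the coefficient of [w] with 1 at that
   vertex and [x] elsewhere. *)
- move=> w; under eq_bigr => e _ do rewrite ones_coef_diff bdry_ones_set1.
  exact: C_even.
- under eq_bigr => e _ do
    rewrite ones_coef_diff bdry_ones_set1 !unit_coef_restr ?cards0 //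
      !unit_coef_one_units.
  rewrite sumr_const card_C; lia.
Qed.

(** The unsigned contribution of adding [f] to [[set e]] to the coefficient of x (x) ... (x) x. *)
Definition glue_coef T e f : int :=
  unit_coef T [set e] (ends f).1 + unit_coef T [set e] (ends f).2.

Definition pairs_coef C T : int :=
  \sum_(e in C) \sum_(f in C | (e < f)%N) ones_coef T [set e; f].

(** Adding the later edge of a pair counts negatively; making all signs positive costs twice the sum
    over those terms. *)
Lemma pairs_coef_bdry C T : {in C &, injective (@endset G)} ->
  pairs_coef C (bdry T) = \sum_(e in C) \sum_(f in C | f != e) glue_coef T e f
    - 2 * \sum_(e in C) \sum_(f in C | (e < f)%N) glue_coef T e f.
Proof.
move=> C_inj; set S := \sum_(e in C) \sum_(f in C | (e < f)%N) glue_coef T e f.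
have -> : pairs_coef C (bdry T)
    = \sum_(e in C) \sum_(f in C | (f < e)%N) glue_coef T e f - S.
  rewrite (exchange_big_dep (mem C)) /=; last by move=> e f _ /andP[].
  rewrite -sumrB; apply: eq_bigr => e eC.
  rewrite [X in _ = X - _](eq_bigl (fun f => (f \in C) && (e < f)%N)) => [|f].
    rewrite -sumrB; apply: eq_bigr => f /andP[fC ef].
    rewrite bdry_ones_set2 //; apply: contraTneq ef => /(C_inj _ _ eC fC)->.
    by rewrite ltnn.
  by rewrite eC.
suff -> : \sum_(e in C) \sum_(f in C | f != e) glue_coef T e f
    = \sum_(e in C) \sum_(f in C | (f < e)%N) glue_coef T e f + S by ring.
rewrite -big_split; apply: eq_bigr => e _ /=.
rewrite (bigID (fun f : E => (f < e)%N)) /=; congr (_ + _); apply: eq_bigl => f.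
  by rewrite -andbA neq_ltn; case: ltngtP; rewrite ?andbF.
by rewrite -andbA neq_ltn; case: ltngtP; rewrite ?andbF.
Qed.

(* On e0 alone, the coboundary would be odd on the pairs made of e0 and a
   parallel edge. *)
Definition parallel_units e0 : family (tens_coef G) := fun s =>
  if [exists g, (s == [set g]) && (endset g == endset e0)] then one_units s
  else 0.

Lemma parallel_units_set1 e0 e : [exists g, ([set e] == [set g])
    && (endset g == endset e0)] = (endset e == endset e0).
Proof.
apply/existsP/idP => [[g /andP[/eqP/set1_inj-> //]]|ee0].
by exists e; rewrite eqxx.
Qed.

(** If the two edges are parallel, both maps only rename factors and the value is a sum of two signs
    times one tensor; otherwise both edges are bridges and each term is even by itself. *)
Lemma parallel_units_even e0 s (c : {ffun comp s -> 'I_2}) : #|s| = 2%N ->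
  (2 %| (bdry (parallel_units e0) s : tens (comp s)) c)%Z.
Proof.
move=> /eqP/cards2P[e [f [ef sE]]].
have sDe : s :\ e = [set f] by rewrite sE setU1K_pair.
have sDf : s :\ f = [set e] by rewrite sE set_pairK.
have es : e \in s by rewrite sE !inE eqxx.
have fs : f \in s by rewrite sE !inE eqxx orbT.
rewrite bdry_coef (eq_bigl (mem [set e; f])) => [|g]; last by rewrite -sE.
rewrite big_setU1 ?inE //= big_set1 /parallel_units.
have [be bf] : bridges s e = (endset f != endset e) /\
    bridges s f = (endset e != endset f).
  by rewrite /bridges sDe sDf !connect_set1.
have -> : [exists g, (s :\ e == [set g]) && (endset g == endset e0)]
  = (endset f == endset e0) by rewrite sDe parallel_units_set1.
have -> : [exists g, (s :\ f == [set g]) && (endset g == endset e0)]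
  = (endset e == endset e0) by rewrite sDf parallel_units_set1.
have push00 r : (push id s (0 : tens (comp r)) : tens (comp s)) c = 0.
  by rewrite /push (raddf0 (tens_map _)) ffunE.
have sign_odd n : (2 %| ((-1) ^+ n - 1)%R)%Z.
  by rewrite -signr_odd; case: odd.
have [efE|efN] := eqVneq (endset e) (endset f).
  rewrite -efE; case: ifP => _; last by rewrite !push00 !mul0r addr0.
  rewrite !push_one_unit_same ?be ?bf ?efE ?eqxx // -mulrDr; apply: dvdz_mull.
  rewrite (_ : _ + _ = ((-1) ^+ before s e - 1) + ((-1) ^+ before s f - 1) +
    2); last by ring.
  by apply: rpredD => //; apply: rpredD; apply: sign_odd.
apply: rpredD; apply: dvdz_mulr; case: ifP => _; rewrite ?push00 ?dvdz0 //;
  by apply: push_one_unit_even; rewrite ?be ?bf // eq_sym.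
Qed.

Lemma dvdz_double (x : int) : (2 %| x + x)%Z.
Proof. by apply/dvdzP; exists x; rewrite mulrDr mulr1. Qed.

Lemma even_cycle_2torsion k : ~~ odd k -> (3 <= k)%N -> has_cycle G k ->
  has_2torsion (coh_deg G 2 (#|V| - 2)).
Proof.
move=> even_k k3 /(cycle_edge_set k3)[C [card_C C_inj C_even]].
have [e0 e0C] : exists e0, e0 \in C.
  by apply/card_gt0P; rewrite card_C (leq_trans _ k3).
have phiE i (t : cochain G i) :
    pairs_coef C (ext (diff t)) = pairs_coef C (bdry (ext t)).
  by apply: eq_bigr => e _; apply: eq_bigr => f _; apply: ones_coef_diff.
apply: (@coh_2torsion _ 1 _ (restr 1 (parallel_units e0))
  (fun t => pairs_coef C (ext t))).
- move=> s b; have /cards1P[e se] := valP s.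
  rewrite ffunE /parallel_units; case: ifP => _; last by rewrite ffunE.
  rewrite ffunE pnatr_eq0 eqb0 negbK => /eqP.
  rewrite (_ : #|comp _| = (#|V| - 1)%N); last by rewrite se card_comp_set1.
  by move=> h; rewrite -[2%N]/(1 + 1)%N subnDA -h subn1.
- by move=> s b; rewrite diff_restr; apply/parallel_units_even/eqP/(valP s).
- move=> t u; rewrite -big_split; apply: eq_bigr => e _.
  by rewrite -big_split; apply: eq_bigr => f _; apply: ones_coef_extD.
- move=> w; rewrite phiE pairs_coef_bdry //; apply: rpredB;
  last exact: dvdz_mulr.
  (* For fixed [e] the sum over all of [C] is even by [C_even]; the omitted term [f = e] is even
     too, as both ends of [e] lie in one component of [[G:{e}]]. *)
  apply: rpred_sum => e eC.
  have -> : \sum_(f in C | f != e) glue_coef (ext w) e f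
      = \sum_(f in C) glue_coef (ext w) e f - glue_coef (ext w) e e.
    by rewrite [X in _ = X - _](bigD1 e) //= addrC addrK.
  apply: rpredB; first exact: C_even.
  rewrite /glue_coef /unit_coef.
  have -> : comp_of [set e] (ends e).1 = comp_of [set e] (ends e).2.
    by apply/eqP; rewrite comp_of_eq connect_set1.
  exact: dvdz_double.
- rewrite phiE pairs_coef_bdry //.
  (* Edges of [C] are pairwise non-parallel, so [e0] is the only one on which the cochain is
     nonzero. *)
  have glueE e f : e \in C ->
      glue_coef (ext (restr 1 (parallel_units e0))) e f = (2 * (e == e0))%:R.
    move=> eC; rewrite /glue_coef !unit_coef_restr ?cards1 //.
    rewrite /unit_coef /parallel_units parallel_units_set1 (inj_in_eq C_inj) //.
    by case: eqP => _; rewrite /one_units ?one_unit_zero_at // !ffunE.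
  have -> : \sum_(e in C) \sum_(f in C | f != e)
      glue_coef (ext (restr 1 (parallel_units e0))) e f = (2 * (k - 1))%:R.
    rewrite (bigD1 e0) //= [X in _ + X]big1 => [|e /andP[eC ee0]].
      under eq_bigr => f _ do rewrite glueE // eqxx.
      rewrite addr0 sumr_const -mulrnA; congr (_ *+ (_ * _)).
      rewrite -card_C (cardsD1 e0) e0C addKn; apply: eq_card => f.
      by rewrite !inE andbC.
    by rewrite big1 // => f _; rewrite glueE // (negPf ee0).
  (* The correction sum is even, so its double vanishes modulo 4, leaving 2 (k - 1) with k - 1
     odd. *)
  have [m ->] : exists m : int, \sum_(e in C) \sum_(f in C | (e < f)%N)
      glue_coef (ext (restr 1 (parallel_units e0))) e f = m * 2.
    apply/dvdzP; apply: rpred_sum => e eC; apply: rpred_sum => f _.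
    by rewrite glueE //; case: eqP.
  lia.
Qed.

End CycleTorsion.

Local Close Scope ring_scope.

Theorem theorem21 (G : mgraph) (v : nat) (hv : #|vert G| = v) :
  (has_torsion (coh_total G) <->
     loopless G /\ exists2 k : nat, 3 <= k & has_cycle G k) /\
  (loopless G /\ (exists2 k : nat, 3 <= k & has_cycle G k) ->
     (forall k : nat, odd k -> 3 <= k -> has_cycle G k ->
        has_2torsion (coh_deg G 1 (v - 1))) /\
     (forall k : nat, ~~ odd k -> 4 <= k -> has_cycle G k ->
        has_2torsion (coh_deg G 2 (v - 2)))).
Proof.
rewrite -{}hv; split; last first.
  move=> [noloop _]; split=> k k_odd k_ge.
    exact: odd_cycle_2torsion.
  by apply: even_cycle_2torsion => //; apply: ltnW.
split=> [tors|[noloop [k k3 cyc]]].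
  apply: contrapT => noncyclic; move: tors; apply: coh_total_torsion_free => i.
  apply: coh_torsion_free.
  have [noloop|loop_G] := pselect (loopless G); [right|left].
    move=> F; apply: acyclic_leaf => // k k3 cyc.
    by apply: noncyclic; split=> //; exists k.
  by move/existsNP: loop_G => [e /negP/negPn/eqP]; exists e.
(* The cycle has at least 3 edges, so degrees 1 and 2 are within the range of the finite sum
   [coh_total]. *)
have [C [card_C _ _]] := cycle_edge_set k3 cyc.
have E3 : 3 <= nedges G.
  by rewrite -(card_ord (nedges G)) (leq_trans k3) // -card_C max_card.
have [odd_k|even_k] := boolP (odd k).
  apply: (coh_total_torsion (ltnW (ltnW E3)) (leq_subr 1 _)).
  exact: (odd_cycle_2torsion noloop odd_k k3 cyc).
apply: (coh_total_torsion (ltnW E3) (leq_subr 2 _)).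
exact: (even_cycle_2torsion noloop even_k k3 cyc).
Qed.
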